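(* Let $A$ and $B$ be nonempty finite subsets of an abelian group $G$ (written multiplicatively, with identity $1$), with $|A| = |B|$ and $1 \notin A$. Assume that for each nonempty subset $R$ of $B$, we have $|\langle R \rangle \cap A| \geq |R|$. Then the pair $(A,B)$ is matchable.
   Context: For nonempty finite subsets $A,B$ of an abelian group $G$ with $|A|=|B|$, a matching from $A$ to $B$ is a bijection $f:A\to B$ such that $af(a)\notin A$ for all $a\in A$. The pair $(A,B)$ is matchable if at least one matching from $A$ to $B$ exists. For a subset $X\subseteq G$, $\langle X\rangle$ denotes the subgroup of $G$ generated by $X$. *)

(* Defs.v *)
From mathcomp Require Export all_boot monoid finmap.
From mathcomp Require Export boolp classical_sets.

Set Implicit Arguments.
Unset Strict Implicit.
Unset Printing Implicit Defensive.

Local Open Scope group_scope.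
Local Open Scope fset_scope.

Definition generated_subgroup (G : groupType) (X : {fset G}) : set G :=
  smallest (fun H : set G => group_closed (mem H)) [set` X].

Definition is_matching (G : groupType) (A B : {fset G}) (f : A -> B) : Prop :=
  bijective f /\ forall a : A, val a * val (f a) \notin A.

Definition matchable (G : groupType) (A B : {fset G}) : Prop :=
  exists f : A -> B, is_matching f.

(* Main.v *)
Require Import Defs.

Set Implicit Arguments.
Unset Strict Implicit.
Unset Printing Implicit Defensive.

(** Hall's marriage theorem reduces the claim to a sumset inequality: if [S]
    and [S R] lie in [A] and [R] lies in [B], then [|S| + |R| <= |A|].
    Dyson's transform at [e] in [S] replaces [S] by [S \cup e R] and [R] by
    [R \cap e^-1 S]; it preserves [|S| + |R|] and all
    the hypotheses.  When it no longer shrinks [R], we have [S R = S], so [S] is a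
    union of cosets of [<R>].  As [1] is not in [S], the sets [S] and
    [<R> \cap A] are disjoint subsets of [A], and the latter has at least [|R|]
    elements. *)

Local Open Scope group_scope.
Local Open Scope fset_scope.

Section Hall.

Variables T U : finType.
Implicit Types (E : T -> {set U}) (S X : {set T}).

Local Notation nbhd E S := (\bigcup_(x in S) E x)%SET.

Definition hall_condition E := forall S, #|S| <= #|nbhd E S|.

Definition delete_edge E x u := fun z => if z == x then (E x :\ u)%SET else E z.

Lemma delete_edge_sub E x u z : delete_edge E x u z \subset E z.
Proof. by rewrite /delete_edge; case: eqP => [->|_] //; apply: subD1set. Qed.

(** A violator [S] of the thinned graph contains [x], since all other neighbourhoods are unchanged.
    Removing [x] from [S] gives [X] and turns the strict inequality into a weak one. *)
Lemma delete_edge_violation E x u : hall_condition E ->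
  ~ hall_condition (delete_edge E x u) ->
  exists X, x \notin X /\ #|(nbhd E X :|: E x :\ u)%SET| <= #|X|.
Proof.
move=> hallE /existsNP[S /negP]; rewrite -ltnNge => ltS.
have nbhd' z : z != x -> delete_edge E x u z = E z.
  by rewrite /delete_edge => /negbTE->.
have xS : x \in S.
  apply: contraLR ltS => xS; rewrite -leqNgt.
  rewrite (eq_bigr E) ?hallE // => z zS; apply: nbhd'.
  by apply: contraNneq xS => <-.
exists (S :\ x)%SET; rewrite !inE eqxx; split=> //.
rewrite -ltnS [ltnRHS](_ : _ = #|S|); last by rewrite (cardsD1 x S) xS.
apply: leq_ltn_trans ltS; apply: subset_leq_card; rewrite finset.subUset.
apply/andP; split.
  apply/bigcupsP => z; rewrite !inE => /andP[zx zS].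
  by rewrite -(nbhd' _ zx) (finset.bigcup_sup z).
apply: (fintype.subset_trans _ (finset.bigcup_sup x xS)).
by rewrite /delete_edge eqxx.
Qed.

(* Rado's deletion step: if both deletions failed, with violators [X] and [Y],
   submodularity of [#|nbhd E _|] would contradict Hall's condition at
   [x |: (X :|: Y)] and [X :&: Y]. *)
Lemma hall_delete E x u v : u \in E x -> v \in E x -> u != v ->
  hall_condition E ->
  hall_condition (delete_edge E x u) \/ hall_condition (delete_edge E x v).
Proof.
move=> uE vE uv hallE; apply: contrapT => /not_orP[].
move=> /(delete_edge_violation hallE)[X [xX leX]].
move=> /(delete_edge_violation hallE)[Y [xY leY]].
set A := (_ :|: _)%SET in leX; set B := (_ :|: _)%SET in leY.
(* As [u != v], the sets [E x :\ u] and [E x :\ v] together cover [E x]. *)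
have leU : #|nbhd E (x |: (X :|: Y))%SET| <= #|(A :|: B)%SET|.
  apply/subset_leq_card/bigcupsP => z; rewrite !inE => /orP[/eqP->|zXY].
    apply/fintype.subsetP => w wE; rewrite !inE wE !andbT.
    have [->|] := eqVneq w u; first by rewrite uv !orbT.
    by rewrite !orbT.
  apply/fintype.subsetP => w wE; rewrite !inE.
  by case/orP: zXY => zX; apply/orP; [left|right]; apply/orP; left;
    apply/bigcupP; exists z.
have leI : #|nbhd E (X :&: Y)%SET| <= #|(A :&: B)%SET|.
  apply/subset_leq_card/bigcupsP => z; rewrite inE => /andP[zX zY].
  apply/fintype.subsetP => w wE; rewrite !inE.
  by apply/andP; split; apply/orP; left; apply/bigcupP; exists z.
(* Since [x] lies outside [X] and [Y], the left side is [#|X| + #|Y| + 1], while the right side is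
   at most [#|X| + #|Y|]. *)
have := leq_add (leq_trans (hallE _) leU) (leq_trans (hallE _) leI).
rewrite cardsUI cardsU1 inE (negbTE xX) (negbTE xY) /= -addnA cardsUI.
by rewrite add1n ltnNge leq_add.
Qed.

(** Induction on the number of edges: a vertex with two neighbours can lose one of them. Once no
    vertex has two, Hall's condition on singletons defines [f], and on pairs it makes [f]
    injective. *)
Lemma hall_marriage E : hall_condition E ->
  exists f : T -> U, injective f /\ forall x, f x \in E x.
Proof.
have [n] := ubnP (\sum_x #|E x|); elim: n E => // n IHn E ltn hallE.
have [/existsP[x]|/existsPn single] := boolP [exists x, 1 < #|E x|].
  case/card_gt1P => u [v] [uE vE uv].
  have step w : w \in E x -> hall_condition (delete_edge E x w) ->
      exists f : T -> U, injective f /\ forall x, f x \in E x.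
    move=> wE /IHn[|f [finj fE]].
      rewrite -ltnS; apply: leq_trans ltn; rewrite ltnS.
      rewrite (bigD1 x) //= [ltnRHS](bigD1 x) //=.
      rewrite -addSn leq_add //; last first.
        by apply: leq_sum => z _; apply/subset_leq_card/delete_edge_sub.
      by rewrite /delete_edge eqxx [ltnRHS](cardsD1 w) wE.
    by exists f; split=> // z; apply: (fintype.subsetP (delete_edge_sub E x w z)).
  by case: (hall_delete uE vE uv hallE); apply: step.
have ex x : exists u, u \in E x.
  by apply/card_gt0P; have := hallE [set x]%SET; rewrite big_set1 cards1.
exists (fun x => xchoose (ex x)); split=> [x y fxy|x]; last exact: xchooseP.
apply/eqP; apply: contraT => xy.
have := hallE [set x; y]%SET; rewrite cards2 xy big_setU1 ?inE //= big_set1.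
have E1 z : E z = [set xchoose (ex z)]%SET.
  apply/esym/eqP; rewrite eqEcard finset.sub1set (xchooseP (ex z)).
  by rewrite cards1 leqNgt single.
by rewrite (E1 x) (E1 y) fxy finset.setUid cards1.
Qed.

End Hall.

(** The elements whose right translation preserves membership in [S] form a subgroup [H]. It
    contains [R]: [S] is finite and translation injective, so [S r] inside [S] forces equality. *)
Lemma generated_subgroup_stab (G : groupType) (S R : {fset G}) (s k : G) :
  (forall s r, s \in S -> r \in R -> s * r \in S) ->
  k \in generated_subgroup R -> (s * k \in S) = (s \in S).
Proof.
move=> SR; rewrite in_setE => kR.
pose H := [set k | forall s, (s * k \in S) = (s \in S)]%classic.
suff /(_ _ kR)/(_ s) : (generated_subgroup R `<=` H)%classic by [].
apply: smallest_sub => [|r /= rR {}s].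
  split=> [|x y]; rewrite !in_setE; first by move=> t; rewrite mulg1.
  move=> /= xS yS {}s.
  by rewrite -(yS (s * (x / y))) -mulgA divgK xS.
apply/idP/idP => [srS|/SR-> //].
have /fsetP imS : [fset x * r | x in S] = S.
  apply/eqP; rewrite eqEfcard card_imfset /=; last exact: mulIg.
  by rewrite leqnn andbT; apply/fsubsetP => _ /imfsetP[x /= xS ->]; apply: SR.
by move: srS; rewrite -imS => /imfsetP[x /= xS /mulIg->].
Qed.

Lemma leq_card_add_stable (G : groupType)
    (G_abelian : forall x y : G, x * y = y * x) (A S R : {fset G}) :
  1 \notin A ->
  (forall Q : {fset G}, Q != fset0 -> Q `<=` R ->
     (#|` Q| <= #|` [fset x in A | x \in generated_subgroup Q]|)%N) ->
  S `<=` A -> (forall s r, s \in S -> r \in R -> s * r \in A) ->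
  (#|` S| + #|` R| <= #|` A|)%N.
Proof.
move=> A1; have [n] := ubnP #|` R|; elim: n S R => // n IHn S R ltn genR SA SR.
(* An [r] with [e r] outside [S] drops out of [R'], so the induction hypothesis applies. *)
have [/existsP[e /existsP[r eSr]]|] :=
  boolP [exists e : S, exists r : R, val e * val r \notin S].
  set e' := val e in eSr; set r' := val r in eSr.
  have eS : e' \in S := valP e.
  have rR : r' \in R := valP r.
  pose S' := S `|` [fset e' * x | x in R].
  pose R' := [fset x in R | e' * x \in S].
  have R'R : R' `<=` R by apply/fsubsetP => x; rewrite !inE => /andP[].
  (* The translate of [R'] by [e'] is the intersection of [S] with that of [R]. *)
  have card' : (#|` S'| + #|` R'| = #|` S| + #|` R|)%N.
    have cardM (Q : {fset G}) : #|` [fset e' * x | x in Q]| = #|` Q|.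
      by rewrite card_imfset //; apply: mulgI.
    rewrite -(cardM R) -[RHS]cardfsUI -(cardM R'); congr (_ + #|` _|)%N.
    apply/fsetP => x; rewrite !inE.
    apply/imfsetP/andP => [[y /=]|[xS /imfsetP[y /= yR xE]]].
      by rewrite !inE => /andP[yR yS] ->; split=> //; apply: in_imfset.
    by exists y; rewrite // !inE yR -xE.
  rewrite -card'; apply: IHn => [|Q Q0 QR'|| s x].
  - rewrite -ltnS; apply: leq_trans ltn; rewrite ltnS; apply: fproper_ltn_card.
    rewrite fproperE R'R /=; apply/fsubsetPn; exists r' => //.
    by rewrite !inE rR.
  - by apply: genR => //; apply: fsubset_trans QR' R'R.
  - rewrite fsubUset SA; apply/fsubsetP => _ /imfsetP[x /= xR ->]; exact: SR.
  (* Commutativity gives [e' y x = (e' x) y], where [e' x] is in [S] because [x] is in [R']. *)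
  rewrite !inE => /orP[sS|/imfsetP[y /= yR ->]] /andP[xR exS]; first exact: SR.
  by rewrite -mulgA (G_abelian y) mulgA SR.
move=> /existsPn stab.
have {}SR s r : s \in S -> r \in R -> s * r \in S.
  by move=> sS rR; have /existsPn/(_ [` rR]) := stab [` sS]; rewrite negbK.
have [->|R0] := eqVneq R fset0.
  by rewrite cardfs0 addn0 fsubset_leq_card.
apply: leq_trans (leq_add (leqnn _) (genR R R0 (fsubset_refl R))) _.
rewrite -cardfsUI (_ : _ `&` _ = fset0) ?cardfs0 ?addn0; last first.
  (* A common element [x = 1 * x] would put [1] in [S] by stability. *)
  apply/fsetP => x; rewrite !inE; apply/negP => /and3P[xS _ xR].
  move: A1; rewrite (fsubsetP SA) //.
  by rewrite -(generated_subgroup_stab 1 SR xR) mul1g.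
apply: fsubset_leq_card; rewrite fsubUset SA.
by apply/fsubsetP => x; rewrite !inE => /andP[].
Qed.

Theorem corollary2p4 (G : groupType)
    (G_abelian : forall x y : G, x * y = y * x)
    (A B : {fset G})
    (A_nonempty : A != fset0) (B_nonempty : B != fset0)
    (card_AB : #|` A| = #|` B|)
    (one_notin_A : 1 \notin A)
    (gen_card : forall R : {fset G}, R != fset0 -> R `<=` B ->
       (#|` R| <= #|` [fset x in A | x \in generated_subgroup R]|)%N) :
  matchable A B.
Proof.
pose E (a : A) := [set b : B | val a * val b \notin A]%SET.
have hallE : hall_condition E.
  (* No element of [R] is an admissible partner for [X], so all products of [S] and [R] lie in [A].
     As [#|N| + #|R| = #|B| = #|A|], Hall's condition becomes the sumset inequality. *)
  move=> X; pose N := (\bigcup_(a in X) E a)%SET.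
  pose S := [fset val a | a in X]; pose R := [fset val b | b in (~: N)%SET].
  have cardX : #|` S| = #|X| by rewrite card_imfset ?cardE //; apply: val_inj.
  have cardN : (#|N| + #|` R|)%N = #|` B|.
    by rewrite card_imfset /= -?cardE ?cardsC ?cardfE //; apply: val_inj.
  rewrite -cardX -/N -(leq_add2r #|` R|) cardN -card_AB.
  have RB : R `<=` B by apply/fsubsetP => _ /imfsetP[b _ ->]; apply: valP.
  apply: leq_card_add_stable => //.
  - by move=> Q Q0 QR; apply: gen_card => //; apply: fsubset_trans QR RB.
  - by apply/fsubsetP => _ /imfsetP[a _ ->]; apply: valP.
  move=> _ _ /imfsetP[a /= aX ->] /imfsetP[b /= bN ->].
  move: bN; rewrite inE; apply: contraNT => abA.
  by apply/bigcupP; exists a; rewrite // inE.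
have [f [finj fE]] := hall_marriage hallE.
exists f; split; last by move=> a; have := fE a; rewrite inE.
by apply: inj_card_bij finj _; rewrite -!cardfE card_AB.
Qed.
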